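(* Fix an allocation rule $\alpha$ and a threshold function $\eta$ (with $\eta(t)\in\Theta_t$). Suppose that the Integrability, Full support and Stochastic dominance assumptions hold. The mechanism $\{\alpha,\phi,\xi,\rho\}$ is dynamic incentive-compatible (DIC) if the following statements are satisfied for potential functions $\beta^{\alpha}_{S,t},\beta^{\alpha}_{\bar S,t}:\Theta_t\to\mathbb{R}$, $t\in\mathbb{T}$, depending only on $\alpha$: (i) The payment rules are constructed as $$\phi_t(\theta_t)=\delta^{-t}\beta^{\alpha}_{\bar S,t}(\theta_t)-\delta^{-t}\mathbb{E}^{\alpha|\theta_t}\big[\beta^{\alpha}_{\bar S,t+1}(\tilde\theta_{t+1})\big]-u_{1,t}(\theta_t,\alpha_t(\theta_t|h^{\theta}_{t-1})),\quad t\in\mathbb{T}\setminus\{T\},$$ $$\xi_t(\theta_t)=\delta^{-t}\beta^{\alpha}_{S,t}(\theta_t)-u_{1,t}(\theta_t,\alpha_t(\theta_t|h^{\theta}_{t-1})),\quad t\in\mathbb{T},$$ $$\rho(t)=\delta^{-t}\mathbb{E}^{\alpha|\eta(t)}\Big[\sum_{s=t}^{T-1}\big(\beta^{\alpha}_{S,s+1}(\tilde\theta_{s+1}\vee\eta(s+1))-\beta^{\alpha}_{S,s}(\tilde\theta_s\vee\eta(s))\big)-\big(\beta^{\alpha}_{\bar S,s+1}(\tilde\theta_{s+1}\vee\eta(s+1))-\beta^{\alpha}_{\bar S,s}(\tilde\theta_s\vee\eta(s))\big)\Big],\quad t\in\mathbb{T}.$$ (ii) For all $\theta_t,\hat\theta_t\in\Theta_t$,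 $t\in\mathbb{T}$, $$\beta^{\alpha}_{S,t}(\hat\theta_t)-\beta^{\alpha}_{S,t}(\theta_t)\le \ell^{\alpha}_{S,t}(\hat\theta_t,\theta_t),$$ $$\beta^{\alpha}_{\bar S,t}(\hat\theta_t)-\beta^{\alpha}_{\bar S,t}(\theta_t)\le\inf_{\tau\in\mathbb{T}_t}\big\{\ell^{\alpha}_{\bar S,t}(\hat\theta_t,\theta_t;\tau)\big\}-\sup_{\tau'\in\mathbb{T}_t}\rho(\tau'),$$ $$\beta^{\alpha}_{\bar S,t}(\theta_t)\ge\beta^{\alpha}_{S,t}(\theta_t)\quad\text{and}\quad \beta^{\alpha}_{\bar S,T}(\theta_T)=\beta^{\alpha}_{S,T}(\theta_T).$$ (iii) $\beta^{\alpha}_{\bar S,t}$ and $\beta^{\alpha}_{S,t}$ are constructed in terms of $\alpha$ such that, for all $t\in\mathbb{T}\setminus\{T\}$, the following term is non-decreasing in $\theta_t$: $$\chi^{\alpha}_{1,t}(\theta_t)=\mathbb{E}^{\alpha|\theta_t}\big[\beta^{\alpha}_{S,t+1}(\tilde\theta_{t+1})-\beta^{\alpha}_{\bar S,t+1}(\tilde\theta_{t+1})\big]-\big(\beta^{\alpha}_{S,t}(\theta_t)-\beta^{\alpha}_{\bar S,t}(\theta_t)\big).$$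
   Context: Model. $\mathbb{T}=\{1,\dots,T\}$, $T<\infty$, $\mathbb{T}_t=\{t,\dots,T\}$. In period $t$ an agent privately observes a state $\theta_t\in\Theta_t=[\underline\theta_t,\bar\theta_t]\subset\mathbb{R}$ and sends a report $\hat\theta_t\in\Theta_t$ to a principal. $A_t$ is a measurable space of allocations. $h^x_{s,t}=(x_s,\dots,x_t)$, $h^x_t=h^x_{1,t}$. A mechanism $\{\alpha,\phi,\xi,\rho\}$ consists of allocation rules $\alpha_t:\prod_{s\le t}\Theta_s\to A_t$, payment rules $\phi_t,\xi_t:\prod_{s\le t}\Theta_s\to\mathbb{R}$ and $\rho:\mathbb{T}\to\mathbb{R}$ with $\rho(T)=0$; one writes $\alpha_t(\hat\theta_t|h^{\hat\theta}_{t-1})$ etc., and the history argument is often suppressed. In period $t$ the allocation is $\alpha_t(\hat\theta_t|h^{\hat\theta}_{t-1})$; the agent receives payment $\phi_t(\hat\theta_t|h^{\hat\theta}_{t-1})$ if he continues and $\xi_t(\hat\theta_t|h^{\hat\theta}_{t-1})+\rho(t)$ if he stops at $t$. The agent's utility $u_{1,t}:\Theta_t\times A_t\to\mathbb{R}$ is, given any allocation rule, Lipschitz continuous in $\theta_t$; $\delta\in(0,1]$ is the discount factor. Dynamics: $\tilde\theta_1$ has c.d.f. $F_1$ and density $f_1$; given $\theta_{t-1}$ and past allocations $h^a_{t-1}$, $\tilde\theta_t$ has c.d.f. $F_t(\cdot|\theta_{t-1},h^a_{t-1})$ and density $f_t(\cdot|\theta_{t-1},h^a_{t-1})$. A reporting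 strategy $\sigma$ is a family of maps $\sigma_t(\theta_t|h^{\hat\theta}_{t-1},h^a_{t-1})\in\Theta_t$. $\Xi_{\alpha;\sigma}$ is the law of the state process under $\alpha,\sigma$, and $\Xi_{\alpha;\sigma}[h^\theta_t]$ is this process given the realized $h^\theta_t$; $\sigma$ is omitted when truthful. For a truthfully reported past $h^\theta_{t-1}$, $\mathbb{E}^{\alpha|\theta_t,\hat\theta_t}$ is the expectation when the period-$t$ state is $\theta_t$, the agent reports $\hat\theta_t$ at $t$ and truthfully in all other periods; $\mathbb{E}^{\alpha|\theta_t}=\mathbb{E}^{\alpha|\theta_t,\theta_t}$; $h^{\hat\theta_t}_s$ is the corresponding history of reports up to $s\ge t$. $x\vee y=\max\{x,y\}$. Interim payoffs: for $\tau\in\mathbb{T}_t$, with $\hat\theta_s=\sigma_s(\tilde\theta_s|h^{\hat\theta}_{s-1},h^{a}_{s-1})$, $$J^{\alpha,\phi,\xi,\rho}_{1,t}(\tau,\theta_t,\sigma_t(\theta_t);\sigma|h^\theta_{t-1})=\mathbb{E}^{\Xi_{\alpha;\sigma}[h^\theta_t]}\Big[\delta^\tau\big(u_{1,\tau}(\tilde\theta_\tau,\alpha_\tau(\hat\theta_\tau|h^{\hat\theta}_{\tau-1}))+\xi_\tau(\hat\theta_\tau|h^{\hat\theta}_{\tau-1})\big)+\sum_{s=1}^{\tau-1}\delta^s\big(u_{1,s}(\tilde\theta_s,\alpha_s(\hat\theta_s|h^{\hat\theta}_{s-1}))+\phi_s(\hat\theta_s|h^{\hat\theta}_{s-1})\big)\Big]+\rho(\tau),$$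 written $J_{1,t}(\tau,\theta_t|h^\theta_{t-1})$ if $\sigma$ is truthful. Valuations: $V_t(\theta_t;\sigma)=\sup_{\tau\in\mathbb{T}_t}J_{1,t}(\tau,\theta_t,\sigma_t(\theta_t);\sigma|h^\theta_{t-1})$, the supremum over time horizons (stopping times) of the process from $t$, given by the Bellman recursion $V_T(\theta_T;\sigma)=J_{1,T}(T,\theta_T,\sigma_T(\theta_T);\sigma|h^\theta_{T-1})$, $V_t(\theta_t;\sigma)=\max\big(J_{1,t}(t,\theta_t,\sigma_t(\theta_t);\sigma|h^\theta_{t-1}),\mathbb{E}^{\Xi_{\alpha;\sigma}[h^\theta_t]}[V_{t+1}(\tilde\theta_{t+1};\sigma)]\big)$; $V_t(\theta_t)$ for truthful $\sigma$. DIC: for every reporting strategy $\sigma$ and all states and histories, for $t<T$, $\max\big(J_{1,t}(t,\theta_t|h^\theta_{t-1}),\mathbb{E}^{\Xi_\alpha[h^\theta_t]}[V_{t+1}(\tilde\theta_{t+1})]\big)\ge\max\big(J_{1,t}(t,\theta_t,\sigma_t(\theta_t);\sigma|h^\theta_{t-1}),\mathbb{E}^{\Xi_{\alpha;\sigma}[h^\theta_t]}[V_{t+1}(\tilde\theta_{t+1};\sigma)]\big)$, and $J_{1,T}(T,\theta_T|h^\theta_{T-1})\ge J_{1,T}(T,\theta_T,\sigma_T(\theta_T);\sigma|h^\theta_{T-1})$. Assumptions. Integrability: for every $\sigma$ and $t$, $\mathbb{E}^{\Xi_{\alpha;\sigma}}[\sup_{\tau\in\mathbb{T}_t}|J_{1,t}(\tau,\tilde\theta_t,\sigma_t(\tilde\theta_t);\sigma|h^{\tilde\theta}_{t-1})|]<\infty$.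 Full support: $f_t(\theta_t|\theta_{t-1},h^a_{t-1})>0$ for all arguments and all $t\ge2$. Stochastic dominance: for $\theta'_t\ge\theta_t$ and all $\bar\theta_{t+1}\in\Theta_{t+1}$, $h^a_t$, $t<T$: $F_{t+1}(\bar\theta_{t+1}|\theta'_t,h^a_t)\le F_{t+1}(\bar\theta_{t+1}|\theta_t,h^a_t)$. Threshold function: $\eta:\mathbb{T}\to\bigcup_t\Theta_t$ with $\eta(t)\in\Theta_t$, $\eta(T)=\bar\theta_T$ (the agent stops the first time $\theta_t\le\eta(t)$). Length functions: for $\tau>t$, $$\pi^\alpha_t(\theta_t,\hat\theta_t;\tau)=\mathbb{E}^{\alpha|\theta_t,\hat\theta_t}\Big[\delta^tu_{1,t}(\theta_t,\alpha_t(\hat\theta_t|h^\theta_{t-1}))+\sum_{s=t+1}^{\tau}\delta^su_{1,s}(\tilde\theta_s,\alpha_s(\tilde\theta_s|h^{\hat\theta_t}_{s-1}))+\sum_{s=t+1}^{\tau-1}\delta^s\phi_s(\tilde\theta_s|h^{\hat\theta_t}_{s-1})+\delta^\tau\xi_\tau(\tilde\theta_\tau|h^{\hat\theta_t}_{\tau-1})+\rho(\tau)\Big],$$ for $\tau=t$, $\pi^\alpha_t(\theta_t,\hat\theta_t;t)=\delta^tu_{1,t}(\theta_t,\alpha_t(\hat\theta_t|h^\theta_{t-1}))+\delta^t\xi_t(\hat\theta_t|h^\theta_{t-1})+\rho(t)$, and $\pi^\alpha_t(\theta_t;\tau)=\pi^\alpha_t(\theta_t,\theta_t;\tau)$. Then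 $\ell^\alpha_{S,t}(\hat\theta_t,\theta_t)=\delta^tu_{1,t}(\hat\theta_t,\alpha_t(\hat\theta_t|h^\theta_{t-1}))-\delta^tu_{1,t}(\theta_t,\alpha_t(\hat\theta_t|h^\theta_{t-1}))$ and $\ell^\alpha_{\bar S,t}(\hat\theta_t,\theta_t;\tau)=\pi^\alpha_t(\hat\theta_t;\tau)-\pi^\alpha_t(\theta_t,\hat\theta_t;\tau)$. *)

(* Defs.v *)
(* MathComp-Analysis, over an arbitrary R : realType. *)
From HB Require Import structures.
From mathcomp Require Import all_boot all_order all_algebra.
From mathcomp Require Import all_classical all_reals all_analysis.

Set Implicit Arguments.
Unset Strict Implicit.
Unset Printing Implicit Defensive.

Import Order.TTheory GRing.Theory Num.Theory.
Import numFieldNormedType.Exports.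

Local Open Scope classical_set_scope.
Local Open Scope ring_scope.

(* hist X t is X_1 * ... * X_t with the product sigma-algebra; the index 0 of
   the family X is never used. *)
Fixpoint hist (d : nat -> measure_display)
    (X : forall t, measurableType (d t)) (t : nat) :
    {d' : measure_display & measurableType d'} :=
  match t with
  | 0 => existT _ _ (unit : measurableType _)
  | s.+1 => existT _ _ ((projT2 (hist X s) * X s.+1)%type : measurableType _)
  end.

Definition histType (d : nat -> measure_display)
    (X : forall t, measurableType (d t)) (t : nat) := projT2 (hist X t).

(* h^x_t = (x_1, ..., x_t), extracted from a sequence x defined at all dates. *)
Fixpoint trunc (d : nat -> measure_display)
    (X : forall t, measurableType (d t)) (x : forall t, X t) (t : nat) :
    histType X t :=
  match t with
  | 0 => tt
  | s.+1 => (trunc x s, x s.+1)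
  end.

Definition upd (V : Type) (x : nat -> V) (t : nat) (v : V) : nat -> V :=
  fun s => if s == t then v else x s.

(* histories of states, and of reports *)
Notation shist R t :=
  (histType (fun _ : nat => (R : measurableType default_measure_display)) t).

Definition strunc (R : realType) (x : nat -> R) (t : nat) : shist R t :=
  trunc (X := fun _ : nat => (R : measurableType default_measure_display)) x t.

(* Periods are 1, ..., T.  States and reports are real numbers, only those in
   [lo t, hi t] being relevant; every function of them is extended arbitrarily
   (but measurably) outside of that interval. *)
Record environment (R : realType) := Environment {
  T : nat ;
  T_gt0 : (0 < T)%N ;
  lo : nat -> R ;
  hi : nat -> R ;
  lo_le_hi : forall t, lo t <= hi t ;
  dA : nat -> measure_display ;
  A : forall t, measurableType (dA t) ;
  delta : R ;
  delta_itv : 0 < delta <= 1 ;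
  u : forall t, R -> A t -> R ;
  u_measurable : forall t, measurable_fun setT (fun z : R * A t => u z.1 z.2) ;
  u_lipschitz : forall t, (1 <= t <= T)%N -> forall a : A t,
    [lipschitz (u x a : R^o) | x in (`[lo t, hi t] : set R^o)] ;
  (* law and density of the initial state *)
  F1 : probability R R ;
  f1 : R -> R ;
  f1_measurable : measurable_fun setT f1 ;
  f1_ge0 : forall x, 0 <= f1 x ;
  f1_density : forall B : set R, measurable B ->
    F1 B = (\int[lebesgue_measure]_(x in B `&` `[lo 1, hi 1]) (f1 x)%:E)%E ;
  (* law and density of the period-t state, 2 <= t <= T, given the pair
     (state at t-1, allocations of the periods 1, ..., t-1) *)
  F : forall t, R.-pker (R * histType A t.-1) ~> R ;
  f : forall t, R -> histType A t.-1 -> R -> R ;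
  f_measurable : forall t x ha, (2 <= t <= T)%N ->
    measurable_fun setT (@f t x ha) ;
  f_ge0 : forall t x ha y, (2 <= t <= T)%N -> 0 <= @f t x ha y ;
  f_density : forall t x ha (B : set R), (2 <= t <= T)%N ->
    x \in `[lo t.-1, hi t.-1] -> measurable B ->
    F t (x, ha) B =
      (\int[lebesgue_measure]_(y in B `&` `[lo t, hi t]) (@f t x ha y)%:E)%E
}.

Arguments u {R e t}.
Arguments F {R}.
Arguments f {R e t}.

Section Model.
Variables (R : realType) (E : environment R).

Definition Theta (t : nat) : set R := `[lo E t, hi E t].

Definition period (t : nat) : Prop := (1 <= t <= T E)%N.

(* T_t = {t, ..., T} *)
Definition horizons (t : nat) : set nat := [set tau | (t <= tau <= T E)%N].

Definition feasible (theta : nat -> R) : Prop :=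
  forall t, period t -> Theta t (theta t).

Definition cdf_next (t : nat) (y x : R) (ha : histType (A E) t.-1) : \bar R :=
  F E t (x, ha) `]-oo, y]%classic.

Definition full_support : Prop :=
  forall t x (ha : histType (A E) t.-1) y, (2 <= t <= T E)%N ->
    Theta t.-1 x -> Theta t y -> 0 < f x ha y.

Definition stochastic_dominance : Prop :=
  forall t (x x' : R) (ha : histType (A E) t) (y : R), (1 <= t < T E)%N ->
    Theta t x -> Theta t x' -> x <= x' -> Theta t.+1 y ->
    (@cdf_next t.+1 y x' ha <= @cdf_next t.+1 y x ha)%E.

Definition threshold_function (eta : nat -> R) : Prop :=
  (forall t, period t -> Theta t (eta t)) /\ eta (T E) = hi E (T E).

Record allocation_rule := AllocationRule {
  alloc_fun :> forall t, shist R t -> A E t ;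
  alloc_measurable : forall t, measurable_fun setT (@alloc_fun t)
}.

Record payment_rules := PaymentRules {
  phi : forall t, shist R t -> R ;
  xi : forall t, shist R t -> R ;
  rho : nat -> R ;
  phi_measurable : forall t, measurable_fun setT (@phi t) ;
  xi_measurable : forall t, measurable_fun setT (@xi t) ;
  rho_T : rho (T E) = 0
}.

(* sigma t x hr ha is the period-t report in state x, after the reports hr and
   the allocations ha of the periods 1, ..., t-1 *)
Record strategy := Strategy {
  report_fun :> forall t, R -> shist R t.-1 -> histType (A E) t.-1 -> R ;
  report_measurable : forall t, measurable_fun setT
    (fun z : R * (shist R t.-1 * histType (A E) t.-1) =>
       @report_fun t z.1 z.2.1 z.2.2) ;
  report_Theta : forall t x hr ha, period t -> Theta t x ->
    Theta t (@report_fun t x hr ha)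
}.

Lemma truthful_measurable t : measurable_fun setT
  (fun z : R * (shist R t.-1 * histType (A E) t.-1) => z.1).
Proof. exact: measurable_fst. Qed.

Definition truthful : strategy :=
  @Strategy (fun t x _ _ => x) truthful_measurable
    (fun t x _ _ _ Hx => Hx).

Variables (alpha : allocation_rule) (P : payment_rules).

Definition allocs (r : nat -> R) : forall t, A E t :=
  fun t => @alloc_fun alpha t (strunc r t).

(* Law of the period-t state given the states theta and the reports r of the
   periods before t. *)
Definition law (t : nat) (theta r : nat -> R) : {measure set R -> \bar R} :=
  if (t == 1)%N then (F1 E : {measure set R -> \bar R})
  else F E t (theta t.-1, trunc (allocs r) t.-1).

(* r with its period-t entry replaced by the report that sigma prescribes in
   state theta t; the entries of r before t are the past reports *)
Definition send (sigma : strategy) (t : nat) (theta r : nat -> R) : nat -> R :=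
  upd r t (@report_fun sigma t (theta t) (strunc r t.-1) (trunc (allocs r) t.-1)).

(* Conditional expectation, under alpha and sigma, of the functional g of the
   states and reports up to period t + n, given the states theta and the
   reports r of the periods 1, ..., t: this is the integral of g against the
   composition of the transition laws of the periods t + 1, ..., t + n. *)
Fixpoint expect (sigma : strategy) (n t : nat)
    (g : (nat -> R) -> (nat -> R) -> \bar R) (theta r : nat -> R) : \bar R :=
  match n with
  | 0 => g theta r
  | m.+1 =>
      (\int[law t.+1 theta r]_(x in Theta t.+1)
         let theta' := upd theta t.+1 x in
         expect sigma m t.+1 g theta' (send sigma t.+1 theta' r))%E
  end.

(* The expectation over the whole process up to period t; the initial
   sequences are entirely overwritten on 1, ..., t. *)
Definition expect0 (sigma : strategy) (t : nat)
    (g : (nat -> R) -> (nat -> R) -> \bar R) : \bar R :=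
  expect sigma t 0 g (fun=> 0) (fun=> 0).

Definition payoff (tau : nat) (theta r : nat -> R) : R :=
  delta E ^+ tau * (u (theta tau) (allocs r tau) + xi P (strunc r tau))
  + \sum_(1 <= s < tau)
      delta E ^+ s * (u (theta s) (allocs r s) + phi P (strunc r s)).

(* J_{1,t}(tau, theta_t, sigma_t(theta_t); sigma | .), with the states theta of
   the periods 1, ..., t, the reports r of the periods 1, ..., t-1, and reports
   following sigma from period t on.  A truthfully reported past is r = theta. *)
Definition J (sigma : strategy) (t tau : nat) (theta r : nat -> R) : \bar R :=
  (expect sigma (tau - t) t (fun th rp => (payoff tau th rp)%:E)
     theta (send sigma t theta r)
   + (rho P tau)%:E)%E.

(* Bellman recursion with n periods to go after t *)
Fixpoint value_rec (sigma : strategy) (n t : nat) (theta r : nat -> R) :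
    \bar R :=
  match n with
  | 0 => J sigma t t theta r
  | m.+1 => maxe (J sigma t t theta r)
      (\int[law t.+1 theta (send sigma t theta r)]_(x in Theta t.+1)
         value_rec sigma m t.+1 (upd theta t.+1 x) (send sigma t theta r))%E
  end.

(* V_t(theta_t; sigma) *)
Definition V (sigma : strategy) (t : nat) (theta r : nat -> R) : \bar R :=
  value_rec sigma (T E - t) t theta r.

(* E[V_{t+1}(theta_{t+1}; sigma)] *)
Definition continuation (sigma : strategy) (t : nat) (theta r : nat -> R) :
    \bar R :=
  (\int[law t.+1 theta (send sigma t theta r)]_(x in Theta t.+1)
     V sigma t.+1 (upd theta t.+1 x) (send sigma t theta r))%E.

(* In each period t the past is truthfully reported, and sigma is compared with
   truth-telling from t on. *)
Definition DIC : Prop :=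
  forall (sigma : strategy) (theta : nat -> R), feasible theta ->
    (forall t, (1 <= t < T E)%N ->
       (maxe (J sigma t t theta theta) (continuation sigma t theta theta)
        <= maxe (J truthful t t theta theta)
             (continuation truthful t theta theta))%E)
    /\ (J sigma (T E) (T E) theta theta
        <= J truthful (T E) (T E) theta theta)%E.

Definition integrability : Prop :=
  forall (sigma : strategy) t, period t ->
    (expect0 sigma t (fun theta r =>
       ereal_sup [set `|J sigma t tau theta r| | tau in horizons t]) < +oo)%E.

(* E^{alpha | x, xh}[g], where g depends on the process up to period tau >= t:
   the past h is truthfully reported, the period-t state is x, the period-t
   report is xh, and the later reports are truthful. *)
Definition expect_dev (t tau : nat) (h : nat -> R) (x xh : R)
    (g : (nat -> R) -> (nat -> R) -> \bar R) : \bar R :=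
  expect truthful (tau - t) t g (upd h t x) (upd h t xh).

Definition expect_at (t tau : nat) (h : nat -> R) (x : R)
    (g : (nat -> R) -> (nat -> R) -> \bar R) : \bar R :=
  expect_dev t tau h x x g.

(* pi_t(x, xh; tau) after the truthfully reported past h; for tau = t the sums
   are empty and no expectation is taken. *)
Definition pi_len (t : nat) (h : nat -> R) (x xh : R) (tau : nat) : \bar R :=
  expect_dev t tau h x xh (fun th rp =>
    (delta E ^+ t * u (th t) (allocs rp t)
     + \sum_(t.+1 <= s < tau.+1) delta E ^+ s * u (th s) (allocs rp s)
     + \sum_(t.+1 <= s < tau) delta E ^+ s * phi P (strunc rp s)
     + delta E ^+ tau * xi P (strunc rp tau)
     + rho P tau)%:E).

Definition ell_S (t : nat) (h : nat -> R) (xh x : R) : R :=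
  delta E ^+ t * u xh (allocs (upd h t xh) t)
  - delta E ^+ t * u x (allocs (upd h t xh) t).

Definition ell_C (t : nat) (h : nat -> R) (xh x : R) (tau : nat) : \bar R :=
  (pi_len t h xh xh tau - pi_len t h x xh tau)%E.

End Model.

(* Main.v *)
Require Import Defs.
From HB Require Import structures.
From mathcomp Require Import all_boot all_order all_algebra.
From mathcomp Require Import ring lra.
From mathcomp Require Import all_classical all_reals all_analysis.
From mathcomp Require Import measurable_realfun.

Set Implicit Arguments.
Unset Strict Implicit.
Unset Printing Implicit Defensive.

Import Order.TTheory GRing.Theory Num.Theory.
Import numFieldNormedType.Exports.
Local Open Scope classical_set_scope.
Local Open Scope ring_scope.

(** Write D_t = betaC_t - betaS_t, which is nonnegative and vanishes at T.  On
    a truthful path the payments telescope: the period-t flow delta^t (u + phi)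
    is betaC_t minus the expectation of betaC_(t+1) ([promise_keeping]), and
    stopping at t yields betaS_t + rho(t) ([stop_stage]).  Hence, up to what
    has accrued before t, continuing truthfully until T is worth exactly
    betaC_t(theta_t), and stopping at t is worth D_t - rho(t) less.  The gap
    condition for betaC, read at equal states, forces sup rho <= 0, so that
    this loss is nonnegative ([rho_le0]) and betaC_t is the truthful value.

    It remains to see that no strategy is worth more than betaC_t(theta_t).
    Neither the transition laws nor the potentials remember past reports
    except through the allocations, and payments depend on reports only, so
    the future after true states th and reports r is the one of the truthful
    past r with the same current state.  The one-shot deviation principle then
    applies, by backward induction ([value_le]): a lie followed by stopping is
    deterred by the gap condition for betaS ([J_stop_le]); a lie followed by
    continuing is worth, once later reports are truthful, at most the payoff
    of never stopping before T, and is deterred by the gap condition for betaC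
    at the horizon T ([one_shot]).  Thus the deterministic horizon T alone
    handles all stopping rules.

    The delicate point is integrability.  After a lie the expectation of
    betaC_(t+1) need not exist, and the measurability in the state of the
    value functions of a strategy would have to be carried through the Bellman
    recursion.  Integrals are therefore compared by pointwise monotonicity,
    which asks for no measurability ([le_integral_pointwise]), and constants
    are moved out of integrals that may be infinite ([integral_shift]); the
    latter needs betaC_t to be measurable, which follows from its gap
    condition ([betaC_measurable]). *)

(** * Integrals against probability measures *)

(** The integral is the difference of two suprema over simple functions, and
    in extended arithmetic subtraction is monotone even when the difference is
    of the form oo - oo. *)
Lemma le_integral_pointwise d (X : measurableType d) (R : realType)
    (mu : {measure set X -> \bar R}) (D : set X) (f g : X -> \bar R) :
  (forall x, D x -> (f x <= g x)%E) ->
  (\int[mu]_(x in D) f x <= \int[mu]_(x in D) g x)%E.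
Proof.
move=> fg.
have fgD x : ((f \_ D) x <= (g \_ D) x)%E by exact: lee_restrict.
have mono (k l : X -> \bar R) : (forall x, 0 <= k x)%E ->
    (forall x, k x <= l x)%E ->
    (\int[mu]_x k x <= \int[mu]_x l x)%E.
  move=> k0 kl; rewrite !ge0_integralTE//; last first.
    by move=> x; exact: le_trans (k0 x) (kl x).
  apply: le_ereal_sup => _ [h hk <-].
  by exists h => // x; exact: le_trans (hk x) (kl x).
rewrite !(integral_mkcond D) (integralE _ _ (f \_ D)) (integralE _ _ (g \_ D)).
apply: leeB; apply: mono => // x.
  by rewrite !funeposE ge_max le_max fgD/= le_max lexx orbT.
by rewrite !funenegE ge_max le_max leeN2 fgD/= le_max lexx orbT.
Qed.

(** Since oo - oo = -oo, an integral that is neither +oo nor finite has an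
    infinite negative part; a constant changes the negative part by at most
    its absolute value, hence leaves it infinite. *)
Lemma integral_shift d (X : measurableType d) (R : realType)
    (mu : {measure set X -> \bar R}) (D : set X) (c : R) (g : X -> R) :
  measurable D -> mu D = 1%E -> measurable_fun D g ->
  (\int[mu]_(x in D) (c + g x)%:E = c%:E + \int[mu]_(x in D) (g x)%:E)%E.
Proof.
move=> mD muD; move: c g.
(* The converse inequality is the same one for the constant - c. *)
suff le_shift (c : R) (g : X -> R) : measurable_fun D g ->
    (\int[mu]_(x in D) (c + g x)%:E <= c%:E + \int[mu]_(x in D) (g x)%:E)%E.
  move=> c g mg; apply/eqP; rewrite eq_le le_shift//=.
  have mcg : measurable_fun D (fun x => c + g x) by exact: measurable_funD.
  have := le_shift (- c) _ mcg.
  under eq_integral do rewrite addKr.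
  by rewrite addeC EFinN leeBrDl.
move=> mg.
have mEg : measurable_fun D (EFin \o g) by exact/measurable_EFinP.
have cstD (k : R) : (\int[mu]_(x in D) k%:E = k%:E)%E.
  by rewrite (integral_cst mu mD k%:E) muD mule1.
have int_cst (k : R) : mu.-integrable D (fun=> k%:E).
  apply/integrableP; split; first exact: measurable_cst.
  by under eq_integral do rewrite /=; rewrite cstD ltry.
have [gy|gNy] := eqVneq (\int[mu]_(x in D) (g x)%:E)%E +oo%E.
  by rewrite gy addey// leey.
have [ig|nig] := pselect (mu.-integrable D (EFin \o g)).
  under eq_integral do rewrite EFinD.
  by rewrite (integralD mD (int_cst c) ig) cstD.
have mpos := measurable_funepos mEg; have mneg := measurable_funeneg mEg.
have negy : (\int[mu]_(x in D) ((EFin \o g)^\- x) = +oo)%E.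
  apply: contrapT => /eqP; rewrite -ltey => negfin.
  apply: nig; apply/integrableP; split=> //.
  rewrite -[X in integral _ _ X]/(abse \o (EFin \o g)) fune_abse.
  rewrite ge0_integralD//; apply: lte_add_pinfty => //.
  rewrite ltey; apply: contra gNy => /eqP posy.
  rewrite (integralE _ _ (EFin \o g)) posy addye//.
  by rewrite eqe_oppLR /= lt_eqF.
have negcy : (\int[mu]_(x in D) ((fun x => (c + g x)%:E)^\- x) = +oo)%E.
  have mcg : measurable_fun D (fun x => (c + g x)%:E).
    by apply/measurable_EFinP; exact: measurable_funD.
  have : (\int[mu]_(x in D) ((EFin \o g)^\- x) <=
      \int[mu]_(x in D) ((fun x => (c + g x)%:E)^\- x + `|c|%:E))%E.
    apply: le_integral_pointwise => x _; rewrite !funenegE /=.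
    rewrite -!EFin_max -EFinD lee_fin.
    have := ler_norm c; have := normr_ge0 c; rewrite /Num.max; do 2 case: ifP; lra.
  rewrite negy leye_eq ge0_integralD//; last exact: measurable_funeneg.
  rewrite cstD; case: integral => //.
rewrite (integralE _ _ (fun x => (c + g x)%:E)) negcy.
by rewrite addeNy leNye.
Qed.

(** The bound makes h lower semicontinuous on [a, b] at every x, although K
    depends on x and h may jump upwards away from x; extending h by +oo outside
    of this closed interval keeps it lower semicontinuous. *)
Lemma one_sided_lipschitz_measurable (R : realType) (a b : R) (h : R -> R) :
  (forall x, x \in `[a, b] -> exists K : R, forall y, y \in `[a, b] ->
     h x - h y <= K * `|x - y|) ->
  measurable_fun `[a, b] h.
Proof.
move=> hK; pose l x : \bar R := if x \in `[a, b] then (h x)%:E else +oo%E.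
suff ml : measurable_fun setT l.
  apply/measurable_EFinP; apply: (eq_measurable_fun l).
    by move=> x; rewrite inE /= /l => ->.
  exact: measurable_funTS.
apply: lower_semicontinuous_measurable => x v; rewrite /l.
have [xab|xab _] := boolP (x \in `[a, b]); last first.
  exists (~` `[a, b]%classic).
    apply: open_nbhs_nbhs; split; last exact/negP.
    by apply: closed_openC; exact: itv_closed.
  by move=> y /= /negP/negPf ->; rewrite ltry.
rewrite lte_fin => vh; have [K Kle] := hK _ xab.
have K1 : 0 < `|K| + 1 by rewrite ltr_wpDl.
exists (ball x ((h x - v) / (`|K| + 1))).
  by apply: nbhsx_ballx; rewrite divr_gt0 ?subr_gt0.
move=> y; rewrite /ball /= => xy; case: ifP => yab; last by rewrite ltry.
rewrite lte_fin; move: xy; rewrite ltr_pdivlMr// => xy.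
have := Kle _ yab; have := ler_norm K.
have := normr_ge0 (x - y); nra.
Qed.

(** * Dependence of the process on the past *)
Lemma updE (X : Type) (x : nat -> X) t v : upd x t v t = v.
Proof. by rewrite /upd eqxx. Qed.

Lemma upd_before (X : Type) (x : nat -> X) t v s :
  (s < t)%N -> upd x t v s = x s.
Proof. by rewrite /upd; case: eqP => // ->; rewrite ltnn. Qed.

Lemma upd_id (X : Type) (x : nat -> X) t : upd x t (x t) = x.
Proof. by apply/funext => s; rewrite /upd; case: eqP => [->|]. Qed.

Lemma eq_trunc d (X : forall t, measurableType (d t)) (x y : forall t, X t) t :
  (forall s, (s <= t)%N -> x s = y s) -> trunc x t = trunc y t.
Proof.
elim: t => //= t IH xy; rewrite IH ?xy// => s st.
by apply: xy; exact: leqW.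
Qed.

Section Process.
Variables (R : realType) (E : environment R) (alpha : allocation_rule E).
Implicit Types (th r : nat -> R) (sigma : strategy E).

Lemma eq_strunc r r' t :
  (forall s, (s <= t)%N -> r s = r' s) -> strunc r t = strunc r' t.
Proof. exact: eq_trunc. Qed.

Lemma eq_allocs r r' t :
  (forall s, (s <= t)%N -> r s = r' s) -> allocs alpha r t = allocs alpha r' t.
Proof. by move=> rr'; rewrite /allocs (eq_strunc rr'). Qed.

Lemma eq_law t th r th' r' : th t = th' t ->
  (forall s, (s <= t)%N -> r s = r' s) ->
  law alpha t.+1 th r = law alpha t.+1 th' r'.
Proof.
move=> tht rr'; rewrite /law /= tht.
have -> // : trunc (allocs alpha r) t = trunc (allocs alpha r') t.
apply: eq_trunc => s st; apply: eq_allocs => k ks.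
by apply: rr'; exact: leq_trans ks st.
Qed.

(** The density representation is an integral over the state space only, so
    that it gives the same mass to the state space and to the whole line. *)
Lemma law_Theta t th r : (1 <= t < T E)%N -> Theta E t (th t) ->
  law alpha t.+1 th r (Theta E t.+1) = 1%E.
Proof.
move=> /andP[t1 tT] tht.
have tT' : (2 <= t.+1 <= T E)%N by rewrite ltnS t1.
have -> : law alpha t.+1 th r = F E t.+1 (th t, trunc (allocs alpha r) t).
  by rewrite /law; case: (t) t1.
rewrite (f_density _ tT' tht)//; last exact: measurable_itv.
rewrite -(@prob_kernel _ _ _ _ _ (F E t.+1) (th t, trunc (allocs alpha r) t)).
by rewrite (f_density _ tT' tht)// setTI setIid.
Qed.

(** The conditional expectation integrates over later states only, so that the
    functional may be changed off the realized past. *)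
Lemma eq_expect sigma n t g g' th r :
  (forall th' r', (forall s, (s <= t)%N -> th' s = th s) ->
     (forall s, (s <= t)%N -> r' s = r s) -> g th' r' = g' th' r') ->
  expect alpha sigma n t g th r = expect alpha sigma n t g' th r.
Proof.
elim: n t th r => [|n IH] t th r gg' /=; first exact: gg'.
apply: eq_integral => x _; apply: IH => th' r' thth' rr'.
by apply: gg' => s st; rewrite ?thth' ?rr' ?leqW// ?/send upd_before.
Qed.

Lemma send_truthful t th r : send alpha (truthful E) t th r = upd r t (th t).
Proof. by []. Qed.

End Process.

(** * Consequences of the payment rules and of the gap conditions *)

Section Potentials.
Variables (R : realType) (E : environment R) (alpha : allocation_rule E).
Variables (betaS betaC : nat -> R -> R) (P : payment_rules E).
Implicit Types (th r h : nat -> R) (sigma : strategy E).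

Hypothesis phiE : forall h t x, feasible E h -> (1 <= t < T E)%N ->
  Theta E t x ->
  (phi P (strunc (upd h t x) t))%:E =
     ((delta E ^- t * betaC t x)%:E
      - (delta E ^- t)%:E *
          expect_at alpha t t.+1 h x (fun th _ => (betaC t.+1 (th t.+1))%:E)
      - (u x (allocs alpha (upd h t x) t))%:E)%E.
Hypothesis xiE : forall h t x, feasible E h -> period E t -> Theta E t x ->
  xi P (strunc (upd h t x) t) =
  delta E ^- t * betaS t x - u x (allocs alpha (upd h t x) t).
Hypothesis betaS_gap : forall h t x xh, feasible E h -> period E t ->
  Theta E t x -> Theta E t xh ->
  betaS t xh - betaS t x <= ell_S alpha t h xh x.
Hypothesis betaC_gap : forall h t x xh, feasible E h -> period E t ->
  Theta E t x -> Theta E t xh ->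
  ((betaC t xh - betaC t x)%:E
   <= ereal_inf [set ell_C alpha P t h xh x tau | tau in horizons E t]
      - ereal_sup [set (rho P tau)%:E | tau in horizons E t])%E.
Hypothesis betaS_le_betaC : forall t x, period E t -> Theta E t x ->
  betaS t x <= betaC t x.
Hypothesis betaC_last : forall x, Theta E (T E) x ->
  betaC (T E) x = betaS (T E) x.

Let period_T : period E (T E).
Proof. by rewrite /period T_gt0 leqnn. Qed.

Let feasible_lo : feasible E (lo E).
Proof. by move=> t _; rewrite /Theta /= in_itv /= lexx lo_le_hi. Qed.

Let delta_neq0 t : delta E ^+ t != 0.
Proof. by rewrite expf_neq0// gt_eqF//; case/andP: (delta_itv E). Qed.

Lemma feasible_upd h t x : feasible E h -> Theta E t x ->
  feasible E (upd h t x).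
Proof. by move=> fh xt s ps; rewrite /upd; case: eqP => [->|_]//; exact: fh. Qed.

Lemma ell_C_now t h xh x :
  ell_C alpha P t h xh x t = (ell_S alpha t h xh x)%:E.
Proof.
rewrite /ell_C /pi_len /expect_dev subnn /= !updE !big_geq//.
by rewrite -EFinB /ell_S; congr _%:E; ring.
Qed.

(** The supremum of rho is nonnegative because rho vanishes at T. *)
Lemma betaC_gap_horizon t tau h x xh : feasible E h -> period E t ->
  Theta E t x -> Theta E t xh -> horizons E t tau ->
  ((betaC t xh - betaC t x)%:E <= ell_C alpha P t h xh x tau)%E.
Proof.
move=> fh pt xt xht ttau; apply: le_trans (betaC_gap fh pt xt xht) _.
rewrite -[leRHS]sube0; apply: leeB; first by apply: ereal_inf_lbound; exists tau.
apply: ereal_sup_ubound; exists (T E); last by rewrite rho_T.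
by move/andP: pt => [_ tT]; rewrite /horizons /= tT leqnn.
Qed.

(** At equal states the length function of the horizon t vanishes, and the gap
    condition reduces to 0 <= - sup rho. *)
Lemma rho_le0 t : period E t -> rho P t <= 0.
Proof.
move=> pt; have lot := feasible_lo pt.
have tt : horizons E t t by move/andP: pt => [_ tT]; rewrite /horizons /= leqnn.
have := betaC_gap feasible_lo pt lot lot; rewrite subrr => /le_trans gap.
have {gap} : (0 <= 0 - (rho P t)%:E)%E.
  apply: gap; apply: leeB; last by apply: ereal_sup_ubound; exists t.
  apply: ereal_inf_lbound; exists t => //.
  by rewrite ell_C_now /ell_S subrr.
by rewrite sub0e -EFinN lee_fin oppr_ge0.
Qed.

(** For the horizon t the gap condition bounds the growth of betaC by that of
    the utility at a fixed allocation, which is Lipschitz in the state. *)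
Lemma betaC_measurable t : period E t -> measurable_fun (Theta E t) (betaC t).
Proof.
move=> pt; have /andP[t1 tT] := pt; apply: one_sided_lipschitz_measurable => x xt.
have := @u_lipschitz _ E t pt (allocs alpha (upd (lo E) t x) t).
case/pinfty_ex_gt0 => M _ /= uM.
exists (delta E ^+ t * M) => y yt.
have tt : horizons E t t by rewrite /horizons /= leqnn.
have := betaC_gap_horizon feasible_lo pt yt xt tt.
rewrite ell_C_now lee_fin => /le_trans; apply.
rewrite /ell_S -mulrBr -mulrA ler_wpM2l//.
  by rewrite exprn_ge0// ltW//; case/andP: (delta_itv E).
apply: le_trans (ler_norm _) _.
exact: (uM (x, y)).
Qed.

(** Discounted flow of period t when the agent continues, in state x after the
    reports r. *)
Definition stage t x r :=
  delta E ^+ t * (u x (allocs alpha r t) + phi P (strunc r t)).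

Definition expected_betaC t th r : \bar R :=
  (\int[law alpha t.+1 th r]_(y in Theta E t.+1) (betaC t.+1 y)%:E)%E.

(** As payments are real numbers, the payment rule rules out an infinite
    expectation of betaC on a truthful path. *)
Lemma promise_keeping h t x : feasible E h -> (1 <= t < T E)%N ->
  Theta E t x ->
  ((stage t x (upd h t x))%:E + expected_betaC t (upd h t x) (upd h t x)
   = (betaC t x)%:E)%E.
Proof.
move=> fh tT xt; have := phiE fh tT xt.
rewrite /expect_at /expect_dev subSnn /=.
under eq_integral do rewrite updE.
rewrite -/(expected_betaC t (upd h t x) (upd h t x)) /stage.
have dt : (0 < (delta E ^- t)%:E)%E.
  rewrite lte_fin invr_gt0 exprn_gt0//; by case/andP: (delta_itv E).
case: (expected_betaC _ _ _) => [b| |].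
- rewrite -EFinM -!EFinB -EFinD => -[->]; congr _%:E.
  rewrite addrCA subrr addr0 mulrBr !mulrA divff//; ring.
- by rewrite gt0_muley.
- by rewrite gt0_muleNy.
Qed.

Lemma stop_stage h t x : feasible E h -> period E t -> Theta E t x ->
  delta E ^+ t * (u x (allocs alpha (upd h t x) t)
                  + xi P (strunc (upd h t x) t)) = betaS t x.
Proof.
by move=> fh pt xt; rewrite xiE// addrCA subrr addr0 mulrA divff// mul1r.
Qed.

Definition stop_term t x r :=
  delta E ^+ t * (u x (allocs alpha r t) + xi P (strunc r t)).

(** * Truthful continuation and one-shot deviations *)

Definition accrued t0 t th r : R :=
  \sum_(t0 <= s < t) stage s (th s) r.

Lemma eq_stage t x r r' : (forall s, (s <= t)%N -> r s = r' s) ->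
  stage t x r = stage t x r'.
Proof. by move=> rr'; rewrite /stage (eq_allocs _ rr') (eq_strunc rr'). Qed.

Lemma eq_accrued t0 t th r th' r' :
  (forall s, (s < t)%N -> th s = th' s) ->
  (forall s, (s < t)%N -> r s = r' s) ->
  accrued t0 t th r = accrued t0 t th' r'.
Proof.
move=> tt' rr'; apply: eq_big_nat => s /andP[_ st]; rewrite tt'//.
by apply: eq_stage => k ks; apply: rr'; exact: leq_ltn_trans ks st.
Qed.

Lemma expected_betaC_shift c t th r : (1 <= t < T E)%N -> Theta E t (th t) ->
  (\int[law alpha t.+1 th r]_(y in Theta E t.+1) (c + betaC t.+1 y)%:E
   = c%:E + expected_betaC t th r)%E.
Proof.
move=> tT tht; apply: integral_shift; first exact: measurable_itv.
  exact: law_Theta.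
by apply: betaC_measurable; move/andP: tT => [_ tT]; rewrite /period tT.
Qed.

(** Never stopping before T: by [promise_keeping] the expected flows telescope
    from T back to t, where betaC and betaS agree at T.  Only the current
    report has to be truthful, not the past ones, since r may differ from th
    before t.  The constant c absorbs the flows already realized along the
    induction. *)
Lemma truthful_expect n t c th r : (t + n)%N = T E -> (1 <= t)%N ->
  feasible E r -> th t = r t ->
  expect alpha (truthful E) n t
    (fun th' r' => (c + accrued t (T E) th' r'
                    + stop_term (T E) (th' (T E)) r')%:E) th r
  = (c + betaC t (th t))%:E.
Proof.
elim: n t c th r => [|n IH] t c th r tn t1 fr thr.
  rewrite addn0 in tn; rewrite /= tn /accrued big_geq// addr0 -tn thr.
  have rt : Theta E t (r t) by apply: fr; rewrite tn.
  have -> : betaC t (r t) = betaS t (r t).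
    by move: rt; rewrite tn; exact: betaC_last.
  by rewrite /stop_term -{2 3}(upd_id r t) stop_stage// tn.
have tT : (t < T E)%N by rewrite -tn addnS ltnS leq_addr.
have rt : Theta E t (r t) by apply: fr; rewrite /period t1 ltnW.
rewrite /=; under eq_integral => y yt.
  rewrite (@eq_expect _ _ _ _ _ _ _ (fun th' r' => ((c + stage t (r t) r)
     + accrued t.+1 (T E) th' r' + stop_term (T E) (th' (T E)) r')%:E)).
    rewrite send_truthful updE IH ?addSnnS// ?updE//; first over.
    by apply: feasible_upd => //; move: yt; rewrite inE.
  move=> th' r' tt' rr'; rewrite /accrued (big_ltn tT) addrA.
  rewrite (@eq_stage t (th' t) r' r).
    by rewrite tt'// upd_before// thr.
  by move=> s st; rewrite rr' ?leqW// /send upd_before.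
rewrite expected_betaC_shift ?t1 ?thr// !EFinD -addeA; congr (_ + _)%E.
rewrite -(@promise_keeping r t (r t)) ?t1// upd_id.
by rewrite /expected_betaC (@eq_law _ _ _ t th r r r).
Qed.

(** After a lie at t, [truthful_expect] applies from period t + 1 on, but the
    expectation of betaC at t + 1 may be infinite. *)
Lemma pi_len_last h t x xh : feasible E h -> (1 <= t < T E)%N ->
  Theta E t x -> Theta E t xh ->
  (pi_len alpha P t h x xh (T E)
   = (delta E ^+ t * u x (allocs alpha (upd h t xh) t))%:E
     + expected_betaC t (upd h t x) (upd h t xh))%E.
Proof.
move=> fh tT xt xht; have /andP[t1 tlT] := tT.
rewrite /pi_len /expect_dev -(expected_betaC_shift _ _ tT) ?updE//.
have -> : (T E - t = (T E - t.+1).+1)%N by rewrite subnSK.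
rewrite /=; apply: eq_integral => y; rewrite inE => yt.
set c := delta E ^+ t * _.
rewrite (@eq_expect _ _ _ _ _ _ _ (fun th' r' => (c
    + accrued t.+1 (T E) th' r' + stop_term (T E) (th' (T E)) r')%:E)).
  rewrite send_truthful updE truthful_expect ?updE ?subnKC//.
  by apply: feasible_upd => //; exact: feasible_upd.
move=> th' r' tt' rr'; congr _%:E.
rewrite tt'// upd_before// updE (@eq_allocs _ _ _ r' (upd h t xh)); last first.
  by move=> s st; rewrite rr' ?leqW// /send upd_before.
rewrite rho_T addr0 -/c /accrued /stop_term /stage.
rewrite big_nat_recr//= -[in LHS]addrA.
under [X in _ = _ + X + _]eq_bigr do rewrite mulrDr.
rewrite big_split /= mulrDr; ring.
Qed.

(** A single lie at t followed by truthful reports until T.  The gap condition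
    at the horizon T excludes the value +oo of the expectation, and -oo makes
    the deviation worthless. *)
Lemma one_shot h t x xh : feasible E h -> (1 <= t < T E)%N ->
  Theta E t x -> Theta E t xh ->
  ((stage t x (upd h t xh))%:E + expected_betaC t (upd h t x) (upd h t xh)
   <= (betaC t x)%:E)%E.
Proof.
move=> fh tT xt xht; have /andP[t1 tlT] := tT.
have pt : period E t by rewrite /period t1 ltnW.
have tTh : horizons E t (T E) by rewrite /horizons /= leqnn ltnW.
have := betaC_gap_horizon fh pt xt xht tTh.
rewrite /ell_C !pi_len_last//.
have := promise_keeping fh tT xht.
rewrite /stage; set a := allocs _ _ _; set p := phi _ _.
case: (expected_betaC t (upd h t xh) _) => [b| |]//.
rewrite -EFinD => -[bE].
case: (expected_betaC t (upd h t x) _) => [b'| |]//=; last by rewrite addeNy leNye.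
by rewrite -!EFinD !lee_fin -bE; lra.
Qed.

(** * Dynamic incentive compatibility *)

Lemma J_stop sigma t th r : J alpha P sigma t t th r =
  (accrued 1 t th r + stop_term t (th t) (send alpha sigma t th r)
   + rho P t)%:E.
Proof.
rewrite /J subnn /= -EFinD /payoff -/(stop_term t (th t) _).
rewrite [stop_term _ _ _ + _]addrC.
rewrite -/(accrued 1 t th (send alpha sigma t th r)).
congr (_ + _ + _)%:E; apply: eq_accrued => // s st.
by rewrite /send upd_before.
Qed.

Lemma send_Theta sigma t th r : period E t -> Theta E t (th t) ->
  exists2 xh, Theta E t xh & send alpha sigma t th r = upd r t xh.
Proof.
by move=> pt tht; eexists; last reflexivity; exact: report_Theta.
Qed.

(** By [stop_stage] a stopping agent who reports xh gets betaS_t(xh) minus the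
    utility difference ell_S, and the gap condition for betaS says that this is
    at most betaS_t at the true state. *)
Lemma J_stop_le sigma t th r : feasible E r -> period E t ->
  Theta E t (th t) ->
  (J alpha P sigma t t th r <= (accrued 1 t th r + betaS t (th t) + rho P t)%:E)%E.
Proof.
move=> fr pt tht; rewrite J_stop.
have [xh xht ->] := send_Theta sigma r pt tht.
rewrite lee_fin lerD2r lerD2l.
have := betaS_gap fr pt tht xht; have := stop_stage fr pt xht.
by rewrite /stop_term /ell_S; lra.
Qed.

Lemma J_stop_truthful t th r : feasible E r -> period E t ->
  Theta E t (th t) ->
  J alpha P (truthful E) t t th r
  = (accrued 1 t th r + betaS t (th t) + rho P t)%:E.
Proof.
by move=> fr pt tht; rewrite J_stop /stop_term /send /= stop_stage.
Qed.

Lemma accrued_next t th r y xh : (1 <= t)%N ->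
  accrued 1 t.+1 (upd th t.+1 y) (upd r t xh)
  = accrued 1 t th r + stage t (th t) (upd r t xh).
Proof.
move=> t1; rewrite /accrued big_nat_recr//= upd_before//; congr (_ + _).
by apply: eq_accrued => s st; rewrite upd_before// ltnW.
Qed.

(** The bound holds after arbitrary past reports r, which is what lets the
    induction pass from a one-shot lie to any strategy. *)
Lemma value_le sigma n t th r : (t + n)%N = T E -> (1 <= t)%N ->
  feasible E r -> Theta E t (th t) ->
  (value_rec alpha P sigma n t th r
   <= (accrued 1 t th r + betaC t (th t))%:E)%E.
Proof.
elim: n t th r => [|n IH] t th r tn t1 fr tht.
  rewrite addn0 in tn; have pt : period E t by rewrite /period t1 tn leqnn.
  apply: le_trans (J_stop_le _ fr pt tht) _.
  by rewrite tn rho_T addr0 betaC_last// -tn.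
have tT : (t < T E)%N by rewrite -tn addnS ltnS leq_addr.
have pt : period E t by rewrite /period t1 ltnW.
rewrite /= ge_max; apply/andP; split.
  apply: le_trans (J_stop_le _ fr pt tht) _.
  by rewrite lee_fin -addrA lerD2l; have := rho_le0 pt;
    have := betaS_le_betaC pt tht; lra.
have [xh xht ->] := send_Theta sigma r pt tht.
pose c := accrued 1 t th r + stage t (th t) (upd r t xh).
apply: (@le_trans _ _ (\int[law alpha t.+1 th (upd r t xh)]_(y in Theta E t.+1)
                         (c + betaC t.+1 y)%:E)%E).
  apply: le_integral_pointwise => y yt.
  apply: le_trans (IH _ _ _ _ _ _ _) _; rewrite ?addSnnS ?updE//.
    exact: feasible_upd.
  by rewrite accrued_next.
rewrite expected_betaC_shift ?t1// /c !EFinD -addeA leeD2l//.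
rewrite /expected_betaC (@eq_law _ _ _ _ th _ (upd r t (th t)) (upd r t xh)) ?updE//.
by apply: one_shot; rewrite ?t1.
Qed.

(** Continuing is always one of the two options of the Bellman recursion, and
    doing so until T attains the upper bound of [value_le]. *)
Lemma value_truthful_ge n t th r : (t + n)%N = T E -> (1 <= t)%N ->
  feasible E r -> Theta E t (th t) ->
  ((accrued 1 t th r + betaC t (th t))%:E
   <= value_rec alpha P (truthful E) n t th r)%E.
Proof.
elim: n t th r => [|n IH] t th r tn t1 fr tht.
  rewrite addn0 in tn; have pt : period E t by rewrite /period t1 tn leqnn.
  by rewrite /= J_stop_truthful// tn rho_T addr0 betaC_last// -tn.
have tT : (t < T E)%N by rewrite -tn addnS ltnS leq_addr.
rewrite /= le_max; apply/orP; right.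
pose c := accrued 1 t th r + stage t (th t) (upd r t (th t)).
apply: (@le_trans _ _ (\int[law alpha t.+1 th (upd r t (th t))]_(y in Theta E t.+1)
                         (c + betaC t.+1 y)%:E)%E).
  rewrite expected_betaC_shift ?t1// /c !EFinD -addeA leeD2l//.
  rewrite /expected_betaC.
  rewrite (@eq_law _ _ _ _ th _ (upd r t (th t)) (upd r t (th t))) ?updE//.
  by rewrite -/(expected_betaC _ _ _) promise_keeping ?t1.
apply: le_integral_pointwise => y yt.
apply: le_trans (IH _ _ _ _ _ _ _); rewrite ?addSnnS ?updE//; last first.
  exact: feasible_upd.
by rewrite accrued_next.
Qed.

Lemma dynamic_incentive_compatibility : DIC alpha P.
Proof.
move=> sigma th fth; split=> [t /andP[t1 tT]|]; last first.
  have tht := fth _ period_T.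
  by apply: le_trans (J_stop_le _ fth period_T tht) _; rewrite J_stop_truthful.
have tht : Theta E t (th t) by apply: fth; rewrite /period t1 ltnW.
have tn : (t + (T E - t.+1).+1)%N = T E by rewrite addnS -addSn subnKC.
exact: le_trans (value_le sigma tn t1 fth tht) (value_truthful_ge tn t1 fth tht).
Qed.

End Potentials.

(* betaS is the potential for stopping, betaC the one for continuing (S-bar);
   h is a truthfully reported history, of which only h 1, ..., h (t-1) matter
   next to an explicit period-t state. *)
Theorem proposition2 (R : realType) (E : environment R)
    (alpha : allocation_rule E) (eta : nat -> R)
    (betaS betaC : nat -> R -> R) (P : payment_rules E) :
  threshold_function E eta ->
  integrability alpha P ->
  full_support E ->
  stochastic_dominance E ->
  (* (i) *)
  (forall h t x, feasible E h -> (1 <= t < T E)%N -> Theta E t x ->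
     (phi P (strunc (upd h t x) t))%:E =
     ((delta E ^- t * betaC t x)%:E
      - (delta E ^- t)%:E *
          expect_at alpha t t.+1 h x (fun th _ => (betaC t.+1 (th t.+1))%:E)
      - (u x (allocs alpha (upd h t x) t))%:E)%E) ->
  (forall h t x, feasible E h -> period E t -> Theta E t x ->
     xi P (strunc (upd h t x) t) =
     delta E ^- t * betaS t x - u x (allocs alpha (upd h t x) t)) ->
  (forall h t, feasible E h -> period E t ->
     (rho P t)%:E =
     ((delta E ^- t)%:E *
      expect_at alpha t (T E) h (eta t) (fun th _ =>
        (\sum_(t <= s < T E)
           ((betaS s.+1 (Num.max (th s.+1) (eta s.+1))
             - betaS s (Num.max (th s) (eta s)))
            - (betaC s.+1 (Num.max (th s.+1) (eta s.+1))
               - betaC s (Num.max (th s) (eta s)))))%:E))%E) ->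
  (* (ii) *)
  (forall h t x xh, feasible E h -> period E t ->
     Theta E t x -> Theta E t xh ->
     betaS t xh - betaS t x <= ell_S alpha t h xh x) ->
  (forall h t x xh, feasible E h -> period E t ->
     Theta E t x -> Theta E t xh ->
     ((betaC t xh - betaC t x)%:E
      <= ereal_inf [set ell_C alpha P t h xh x tau | tau in horizons E t]
         - ereal_sup [set (rho P tau)%:E | tau in horizons E t])%E) ->
  (forall t x, period E t -> Theta E t x -> betaS t x <= betaC t x) ->
  (forall x, Theta E (T E) x -> betaC (T E) x = betaS (T E) x) ->
  (* (iii) *)
  (forall h t x x', feasible E h -> (1 <= t < T E)%N ->
     Theta E t x -> Theta E t x' -> x <= x' ->
     let chi (y : R) : \bar R :=
       (expect_at alpha t t.+1 h y
          (fun th _ => (betaS t.+1 (th t.+1) - betaC t.+1 (th t.+1))%:E)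
        - (betaS t y - betaC t y)%:E)%E in
     (chi x <= chi x')%E) ->
  DIC alpha P.
Proof.
move=> _ _ _ _ phiE xiE _ betaS_gap betaC_gap betaS_le_betaC betaC_last _.
exact: (dynamic_incentive_compatibility phiE xiE betaS_gap betaC_gap).
Qed.
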